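(* Let $G$ be a group. Suppose $\omega$ is a commensurability class of approximate subgroups of $G$, equal to $\chi(g)$ for some homogeneous quasimorphism $g:G\to\mathbb{R}^n$, and also to $\chi(f)$ for some homomorphism $f:G\to L$ into a connected locally compact group with dense image. Then $g$ is a homomorphism.
   Context: Subsets of a group are commensurable if each is covered by finitely many right translates of the other; a symmetric subset $\Lambda$ ($1\in\Lambda=\Lambda^{-1}$) is an approximate subgroup if $\Lambda$ and $\Lambda^2$ are commensurable; its commensurability class is the set of approximate subgroups commensurable to it. A homogeneous quasimorphism $g:G\to\mathbb{R}^n$ is a map such that $g(xy)-g(x)-g(y)$ is bounded on $G^2$ and $g(x^k)=kg(x)$ for all $x\in G,k\in\mathbb{Z}$; $\chi(g)$ is the commensurability class of the approximate subgroup $YY^{-1}$, where $Y=g^{-1}(W)$ with $W$ any compact neighborhood of a compact symmetric error set $K\subset\mathbb{R}^n$ (with $g(xy)-g(x)-g(y)\in K$ for all $x,y$); it is independent of choices. For a homomorphism $f$ into a locally compact group, $\chi(f)$ is the commensurability class of $YY^{-1}$ (equivalently, of $Y$ when symmetric) for $Y$ the preimage of any compact neighborhood of the identity. *)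

(* Defs.v *)
From HB Require Import structures.
From mathcomp Require Import all_boot all_order all_algebra.
From mathcomp Require Import all_classical all_reals all_analysis.

Set Implicit Arguments.
Unset Strict Implicit.
Unset Printing Implicit Defensive.

Import Order.TTheory GRing.Theory Num.Theory.
Import numFieldNormedType.Exports.

Local Open Scope classical_set_scope.
Local Open Scope ring_scope.

HB.structure Definition PreTopologicalGroup :=
  {L of Topological L & monoid.Group L}.

HB.mixin Record PreTopologicalGroup_isTopologicalGroup L
    of PreTopologicalGroup L := {
  mulg_continuous : continuous (fun p : L * L => (p.1 * p.2)%g);
  invg_continuous : continuous (fun x : L => (x^-1)%g)
}.

(* No separation axiom is required. *)
#[short(type="topologicalGroupType")]
HB.structure Definition TopologicalGroup :=
  {L of PreTopologicalGroup L & PreTopologicalGroup_isTopologicalGroup L}.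

Section ApproximateSubgroups.
Variable G : groupType.
Implicit Types A B Y : set G.

Definition mulset A B : set G := [set (a * b)%g | a in A & b in B].

Definition invset A : set G := [set (a^-1)%g | a in A].

Definition right_covered A B : Prop :=
  exists2 F : set G, finite_set F & A `<=` mulset B F.

Definition commensurable A B : Prop := right_covered A B /\ right_covered B A.

Definition symmetric_set A : Prop := A 1%g /\ invset A = A.

Definition approximate_subgroup A : Prop :=
  symmetric_set A /\ commensurable A (mulset A A).

Definition comm_class A : set (set G) :=
  [set B | approximate_subgroup B /\ commensurable B A].

Definition is_comm_class (omega : set (set G)) : Prop :=
  exists2 A, approximate_subgroup A & omega = comm_class A.

Definition expgz (x : G) (k : int) : G :=
  match k with Posz m => (x ^+ m)%g | Negz m => (x ^- m.+1)%g end.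

End ApproximateSubgroups.

Section Quasimorphisms.
Variables (G : groupType) (R : realType) (n : nat).
Implicit Types (g : G -> 'rV[R]_n) (K W : set 'rV[R]_n).

Definition qm_defect g (x y : G) : 'rV[R]_n := g (x * y)%g - g x - g y.

Definition homogeneous_quasimorphism g : Prop :=
  [bounded qm_defect g p.1 p.2 | p in [set: G * G]] /\
  forall (x : G) (k : int), g (expgz x k) = g x *~ k.

Definition error_set g K : Prop :=
  [/\ compact K, K 0, [set - v | v in K] = K & forall x y, K (qm_defect g x y)].

(* [omega = chi(g)]. The class does not depend on [K] and [W], so a single
   choice of them determines it. *)
Definition is_chi_qm g (omega : set (set G)) : Prop :=
  exists K W, [/\ error_set g K, compact W, K `<=` W° &
    let Y := g @^-1` W in omega = comm_class (mulset Y (invset Y))].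

End Quasimorphisms.

(* [omega = chi(f)]; here too the class does not depend on [U]. *)
Definition is_chi_hom (G : groupType) (L : topologicalGroupType)
    (f : {multiplicative G -> L}) (omega : set (set G)) : Prop :=
  exists U : set L, [/\ compact U, nbhs (1%g : L) U &
    let Y := f @^-1` U in omega = comm_class (mulset Y (invset Y))].

(* Main.v *)
(* Write A_r for the set of x with |g x| <= r.  Commensurability says that f maps
   each A_r into a compact set and that g is bounded on the preimage of some
   neighbourhood of 1; by homogeneity, g is then uniformly continuous on each A_r
   for the topology pulled back by f.

   Any homogeneous quasimorphism on an amenable group is a homomorphism, and
   amenability comes from polynomial growth.  Instead of Haar measure we count
   points of maximal packings: for a neighbourhood V of 1, the largest
   V-separated subset of A_r has at most (2r+1)^n p points, where p is the packing
   number of A_(1+D) and D bounds the defect.  As this ratio does not depend on V,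
   V may be chosen after the radii, so uniform continuity on a bounded range
   suffices.  Some radius r then satisfies P(r+c) <= (1+delta) P(r), and a maximal
   packing S of A_r is almost invariant under right translation in the weak
   sense: averages over S and S z of slowly varying functions almost agree.  With
   h(w) the average over S of g(sw) - g(s), the function h is almost additive and
   within D of g; comparing both on powers shows that g is additive. *)

Require Import Defs.
From HB Require Import structures.
From mathcomp Require Import all_boot all_order all_algebra.
From mathcomp Require Import all_classical all_reals all_analysis.
From mathcomp Require Import ring lra zify.
Import Order.TTheory GRing.Theory Num.Theory.
Import numFieldNormedType.Exports.
Local Open Scope classical_set_scope.
Local Open Scope ring_scope.

Set Implicit Arguments.
Unset Strict Implicit.
Unset Printing Implicit Defensive.

(** * Separated sets and packing numbers *)

Section Packing.
Variable G : groupType.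
Implicit Types (V A B : set G) (S : seq G).

(** Separation is tested on [s / t], which does not change when both points are multiplied on the
    right by the same element. *)
Definition is_packing V S : Prop :=
  uniq S /\ {in S &, forall s t, s != t -> ~ V (s / t)%g}.

Definition seq_in S A : Prop := {in S, forall s, A s}.

Definition packing_bound V A (p : nat) : Prop :=
  forall S, is_packing V S -> seq_in S A -> (size S <= p)%N.

Definition packing_number V A (p : nat) : Prop :=
  packing_bound V A p /\
  exists S, [/\ is_packing V S, seq_in S A & size S = p].

Lemma is_packing_filter V S (P : pred G) :
  is_packing V S -> is_packing V [seq s <- S | P s].
Proof.
move=> [Su Ss]; split; first exact: filter_uniq.
by move=> s t; rewrite !mem_filter => /andP[_ sS] /andP[_ tS]; exact: Ss.
Qed.

Lemma is_packing_translate V S z :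
  is_packing V S -> is_packing V [seq (s * z)%g | s <- S].
Proof.
move=> [Su Ss]; split; first by rewrite map_inj_uniq//; exact: mulIg.
move=> _ _ /mapP[s sS ->] /mapP[t tS ->] st; rewrite mulgKA.
by apply: Ss => //; apply: contraNneq st => ->.
Qed.

Lemma packing_numberP V A M :
  packing_bound V A M -> exists p, packing_number V A p.
Proof.
move=> AM.
pose P m := `[< exists S, [/\ is_packing V S, seq_in S A & size S = m] >].
have exP : exists m, P m by exists 0%N; apply/asboolP; exists [::].
have leP m : P m -> (m <= M)%N by move=> /asboolP[S [Ss SA <-]]; exact: AM.
have [p /asboolP Pp pmax] := ex_maxnP exP leP.
exists p; split=> // S Ss SA; apply: pmax; apply/asboolP.
by exists S.
Qed.

Lemma packing_number_gt0 V A p :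
  (exists x, A x) -> packing_number V A p -> (0 < p)%N.
Proof.
move=> [x Ax] [pb _]; apply: (pb [:: x]).
  by split=> // s t; rewrite !inE => /eqP-> /eqP->; rewrite eqxx.
by move=> s; rewrite inE => /eqP->.
Qed.

(** Layer-cake formula: [F s] is the number of levels [j < J] lying below it. *)
Lemma sum_count_gt S (F : G -> nat) (J : nat) : {in S, forall s, (F s <= J)%N} ->
  (\sum_(s <- S) F s = \sum_(j < J) count (fun s => j < F s) S)%N.
Proof.
move=> FJ; under [RHS]eq_bigr do rewrite -sum1_count big_mkcond /=.
rewrite exchange_big /=; apply: eq_big_seq => s /FJ.
elim: J {FJ} (F s) => [|J IH] m mJ; first by rewrite big_ord0; lia.
rewrite big_ord_recr /=; case: ltnP => Jm; last by rewrite addn0 -IH.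
rewrite (eq_bigr (fun=> 1%N)); last by move=> i _; rewrite (ltn_trans _ Jm).
by rewrite sum_nat_const card_ord; lia.
Qed.

(* Elements of [S] on which [psi] is small can coexist with elements of [S z]
   on which it is large: were this set too big, it would beat [S]. *)
Lemma layer_swap V S B z (psi : G -> nat) (E j : nat) :
  (forall x, V x -> V x^-1%g) ->
  is_packing V S -> seq_in S B -> seq_in [seq (s * z)%g | s <- S] B ->
  packing_bound V B (size S + E) ->
  (forall s t, B s -> B t -> V (s / t)%g -> (psi s <= (psi t).+1)%N) ->
  (count (fun s => j.+1 < psi (s * z)%g) S <=
     count (fun s => j < psi s) S + E)%N.
Proof.
move=> Vsym Ss SB SzB pb psiV.
pose T := [seq (s * z)%g | s <- S].
have Ts : is_packing V T := is_packing_translate z Ss.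
pose S1 := [seq s <- S | (psi s <= j)%N].
pose T1 := [seq t <- T | (j.+1 < psi t)%N].
have apart s t : s \in S1 -> t \in T1 -> ~ V (t / s)%g /\ t != s.
  rewrite !mem_filter => /andP[sj sS] /andP[tj tT]; split.
    move=> /psiV-/(_ (SzB _ tT) (SB _ sS)) ts.
    by move: (leq_ltn_trans sj (leq_trans tj ts)); rewrite ltnn.
  by apply/eqP => ts; move: tj; rewrite ts; lia.
have : (size (S1 ++ T1) <= size S + E)%N.
  apply: pb.
    split.
      rewrite cat_uniq !filter_uniq ?Ss.1 ?Ts.1//= andbT.
      apply/hasPn => t tT1; apply/negP => tS1.
      by have [_] := apart _ _ tS1 tT1; rewrite eqxx.
    move=> s t; rewrite !mem_cat => /orP[s1|s1] /orP[t1|t1] st.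
    - by apply: (is_packing_filter (fun s => psi s <= j)%N Ss).2.
    - by move=> /Vsym; rewrite invgF; exact: (apart _ _ s1 t1).1.
    - exact: (apart _ _ t1 s1).1.
    - by apply: (is_packing_filter (fun t => j.+1 < psi t)%N Ts).2.
  move=> s; rewrite mem_cat !mem_filter => /orP[/andP[_ /SB]//|/andP[_ /SzB]//].
rewrite size_cat !size_filter count_map.
rewrite -(count_predC (fun s => (j < psi s)%N) S) -addnA addnC [X in (_ <= X)%N]addnC.
rewrite (@eq_count _ (predC _) (fun s => psi s <= j)%N); last first.
  by move=> s /=; rewrite -leqNgt.
rewrite (@eq_count _ (preim _ _) (fun s => j.+1 < psi (s * z)%g)%N)//.
lia.
Qed.

(** Sum of [layer_swap] over the levels [j < J]: each level costs [E], and passing from [j.+1] to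
    [j] costs one unit per element of [S]. *)
Lemma sum_translate_le V S B z (psi : G -> nat) (E J : nat) :
  (forall x, V x -> V x^-1%g) ->
  is_packing V S -> seq_in S B -> seq_in [seq (s * z)%g | s <- S] B ->
  packing_bound V B (size S + E) ->
  (forall s t, B s -> B t -> V (s / t)%g -> (psi s <= (psi t).+1)%N) ->
  (forall s, B s -> psi s <= J)%N ->
  (\sum_(s <- S) psi (s * z)%g <= \sum_(s <- S) psi s + size S + J * E)%N.
Proof.
move=> Vsym Ss SB SzB pb psiV psiJ.
have Szz s : s \in S -> B (s * z)%g by move=> sS; apply: SzB; apply: map_f.
have -> : (\sum_(s <- S) psi s =
    \sum_(j < J) count (fun s => j < psi s) S)%N.
  by apply: sum_count_gt => s /SB/psiJ.
apply: (@leq_trans (\sum_(s <- S) ((psi (s * z)%g).-1 + 1))%N).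
  by apply: leq_sum => s _; lia.
rewrite big_split /= sum1_size addnAC leq_add2r.
rewrite (@sum_count_gt _ (fun s => (psi (s * z)%g).-1) J); last first.
  by move=> s /Szz/psiJ; apply: leq_trans; exact: leq_pred.
rewrite -[X in (X * E)%N]card_ord -sum_nat_const -big_split /=.
apply: leq_sum => j _.
rewrite (@eq_count _ _ (fun s => j.+1 < psi (s * z)%g)%N); last by move=> s /=; lia.
exact: (@layer_swap V S B).
Qed.
End Packing.

(** * Almost invariant averages over packings; polynomial against exponential growth *)

Section Averaging.
Variables (G : groupType) (R : realType).
Implicit Types (V A B : set G) (S : seq G).

(** Rounding [phi + M] down to multiples of [eta] turns variation at most [eta] into steps of at
    most one. The rounding and the unit loss per point each cost [eta]; the levels have total height
    at most [2 * M], whence the term in [delta]. *)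
Lemma sum_translate_le_real V S B z (phi : G -> R) (E : nat) (M eta delta : R) :
  0 < eta -> (forall x, V x -> V x^-1%g) ->
  is_packing V S -> seq_in S B -> seq_in [seq (s * z)%g | s <- S] B ->
  packing_bound V B (size S + E) ->
  (forall s t, B s -> B t -> V (s / t)%g -> `|phi s - phi t| <= eta) ->
  (forall s, B s -> `|phi s| <= M) ->
  E%:R <= delta * (size S)%:R ->
  \sum_(s <- S) (phi (s * z)%g - phi s) <= (2 * eta + 2 * M * delta) * (size S)%:R.
Proof.
move=> eta0 Vsym Ss SB SzB pb phiV phiM Edelta.
pose psi s := Num.truncn ((phi s + M) / eta).
pose J := Num.truncn ((2 * M) / eta).
have psi_lb s : B s -> eta * (psi s)%:R <= phi s + M.
  move=> /phiM; rewrite ler_norml => /andP[Ms _].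
  by rewrite mulrC -ler_pdivlMr// truncn_le divr_ge0//; [lra | exact: ltW].
have psi_ub s : phi s + M < eta * ((psi s)%:R + 1).
  by rewrite mulrC -ltr_pdivrMr// natr1 truncnS_gt.
have psiV s t : B s -> B t -> V (s / t)%g -> (psi s <= (psi t).+1)%N.
  move=> Bs Bt /(phiV _ _ Bs Bt); rewrite ler_norml => /andP[_ st].
  rewrite -ltnS -(ltr_nat R) -(ltr_pM2l eta0).
  have := psi_lb _ Bs; have := psi_ub t; rewrite -!natr1; lra.
have psiJ s : B s -> (psi s <= J)%N.
  move=> /phiM; rewrite ler_norml => /andP[_ Ms].
  by apply: le_truncn; rewrite ler_pM2r ?invr_gt0//; lra.
have := sum_translate_le Vsym Ss SB SzB pb psiV psiJ.
rewrite -(ler_nat R) -(ler_pM2l eta0) !natrD natrM !natr_sum.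
(* A point of [S] is what gives [0 <= M]. *)
have [S0|[s0 s0S]] : S = [::] \/ exists s, s \in S.
- by case: (S) => [|s S']; [left | right; exists s; rewrite mem_head].
- by rewrite S0 !big_nil /= !mulr0.
have M0 : 0 <= M by apply: le_trans (phiM _ (SB _ s0S)).
have JM : eta * J%:R <= 2 * M.
  by rewrite mulrC -ler_pdivlMr// truncn_le divr_ge0//; [lra | exact: ltW].
have JEM : eta * (J%:R * E%:R) <= 2 * M * (delta * (size S)%:R).
  rewrite mulrA; apply: ler_pM => //; apply: mulr_ge0 => //; exact: ltW.
have up : \sum_(s <- S) phi (s * z)%g + M * (size S)%:R <=
    eta * (\sum_(s <- S) (psi (s * z)%g)%:R + (size S)%:R).
  have -> (a : R) : a * (size S)%:R = \sum_(s <- S) a.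
    by rewrite big_const_seq count_predT iter_addr addr0 mulr_natr.
  rewrite -[X in eta * (_ + X)]mul1r.
  have -> (a : R) : a * (size S)%:R = \sum_(s <- S) a.
    by rewrite big_const_seq count_predT iter_addr addr0 mulr_natr.
  rewrite -!big_split /= mulr_sumr; apply: ler_sum => s _; exact/ltW/psi_ub.
have lo : eta * \sum_(s <- S) (psi s)%:R <=
    \sum_(s <- S) phi s + M * (size S)%:R.
  have -> (a : R) : a * (size S)%:R = \sum_(s <- S) a.
    by rewrite big_const_seq count_predT iter_addr addr0 mulr_natr.
  rewrite -!big_split /= mulr_sumr big_seq [leRHS]big_seq.
  apply: ler_sum => s sS; exact: psi_lb (SB _ sS).
rewrite sumrB; lra.
Qed.

Lemma norm_sum_translate V S B z (phi : G -> R) (E : nat) (M eta delta : R) :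
  0 < eta -> (forall x, V x -> V x^-1%g) ->
  is_packing V S -> seq_in S B -> seq_in [seq (s * z)%g | s <- S] B ->
  packing_bound V B (size S + E) ->
  (forall s t, B s -> B t -> V (s / t)%g -> `|phi s - phi t| <= eta) ->
  (forall s, B s -> `|phi s| <= M) ->
  E%:R <= delta * (size S)%:R ->
  `|\sum_(s <- S) (phi (s * z)%g - phi s)| <=
    (2 * eta + 2 * M * delta) * (size S)%:R.
Proof.
move=> eta0 Vsym Ss SB SzB pb phiV phiM Edelta.
rewrite ler_norml lerNl -sumrN; apply/andP; split; last first.
  exact: (@sum_translate_le_real V S B _ _ E).
under eq_bigr do rewrite opprB addrC -[X in _ + X]opprK.
apply: (@sum_translate_le_real V S B _ (fun s => - phi s) E) => // [s t Bs Bt Vst|s Bs].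
  by rewrite -opprD normrN; exact: phiV.
by rewrite normrN; exact: phiM.
Qed.

(** By Bernoulli, [(1 + delta) ^+ t] is at least [t%:R * delta]. Raised to the power [n.+1], this
    has one factor [t] more than a polynomial of degree [n], and a large [t] absorbs the
    constants. *)
Lemma poly_lt_exp (a b n : nat) (delta : R) : 0 < delta ->
  exists J, ((a + J * b) ^ n)%:R < (1 + delta) ^+ J.
Proof.
move=> d0; pose K := (a + n.+1 * b)%N.
pose t := (Num.truncn ((K ^ n)%:R / delta ^+ n.+1)).+1.
have Kt : (K ^ n)%:R < t%:R * delta ^+ n.+1.
  by rewrite -ltr_pdivrMr ?exprn_gt0// truncnS_gt.
exists (n.+1 * t)%N.
have bern m : 1 + m%:R * delta <= (1 + delta) ^+ m.
  elim: m => [|m IH]; first by rewrite mul0r addr0.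
  rewrite exprS -natr1; apply: le_trans (_ : (1 + delta) * (1 + m%:R * delta) <= _).
    have : 0 <= delta * (m%:R * delta) by rewrite !mulr_ge0// ltW.
    lra.
  by rewrite ler_pM2l//; lra.
apply: (@le_lt_trans _ _ ((K * t) ^ n)%:R).
  by rewrite !natrX lerXn2r ?nnegrE ?ler0n// ler_nat /K; nia.
apply: (@lt_le_trans _ _ ((t%:R * delta) ^+ n.+1)); last first.
  rewrite mulnC exprM lerXn2r// ?nnegrE.
  - by rewrite mulr_ge0// ltW.
  - by rewrite exprn_ge0//; lra.
  - by apply: le_trans (bern t); lra.
have -> : ((K * t) ^ n)%:R = t%:R ^+ n * (K ^ n)%:R :> R.
  by rewrite expnMn natrM mulrC [X in X * _ = _]natrX.
have -> : (t%:R * delta) ^+ n.+1 = t%:R ^+ n * (t%:R * delta ^+ n.+1).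
  by rewrite exprMn exprSr mulrA.
by rewrite ltr_pM2l// exprn_gt0// ltr0n.
Qed.

End Averaging.

(** * Unit cells for the maximum norm *)

Section RowNorm.
Variables (R : realType) (n : nat).
Implicit Types v w : 'rV[R]_n.

Lemma coord_le_norm v i : `|v ord0 i| <= `|v|.
Proof.
rewrite [leRHS]/Num.norm /= mx_normrE; apply/bigmax_geP; right => /=.
by exists (ord0, i).
Qed.

Lemma norm_le_coord v r : 0 <= r -> (forall i, `|v ord0 i| <= r) -> `|v| <= r.
Proof.
move=> r0 vr; rewrite [leLHS]/Num.norm /= mx_normrE; apply: bigmax_le => //.
by move=> [i j] _ /=; rewrite ord1.
Qed.

(** The shift by [N] makes the coordinates nonnegative on the ball of radius [N]. A coordinate equal
    to [N] yields the value [N.*2], hence [(N.*2).+1] values; outside the ball the cell carries no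
    meaning. *)
Definition cell (N : nat) v : {ffun 'I_n -> 'I_(N.*2).+1} :=
  [ffun i => inord (Num.truncn (v ord0 i + N%:R))].

Lemma cell_dist N v w : `|v| <= N%:R -> `|w| <= N%:R ->
  cell N v = cell N w -> `|v - w| <= 1.
Proof.
move=> vN wN /ffunP vw; apply: norm_le_coord => // i.
have bnd (u : 'rV[R]_n) : `|u| <= N%:R -> 0 <= u ord0 i + N%:R <= (N.*2)%:R.
  move=> uN; have := le_trans (coord_le_norm u i) uN.
  by rewrite ler_norml -addnn natrD; lra.
have inI (u : 'rV[R]_n) : `|u| <= N%:R -> (Num.truncn (u ord0 i + N%:R) < (N.*2).+1)%N.
  move=> /bnd/andP[u0 uN]; rewrite ltnS -(ler_nat R).
  by apply: le_trans uN; rewrite truncn_le.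
have := vw i; rewrite !ffunE => /(congr1 val) /=; rewrite !inordK ?inI// => vwi.
have /andP[v0 _] := bnd _ vN; have /andP[w0 _] := bnd _ wN.
have /andP[v1 v2] := truncn_itv v0; have /andP[w1 w2] := truncn_itv w0.
rewrite !mxE ler_norml; move: v1 v2 w1 w2; rewrite vwi -natr1; lra.
Qed.

End RowNorm.

(** * Additivity from uniform continuity and packing bounds on balls *)

Section Additivity.
Variables (G : groupType) (R : realType) (n : nat) (g : G -> 'rV[R]_n) (D : R).
Hypothesis g_defect : forall x y, `|qm_defect g x y| <= D.
Hypothesis gX : forall x k, g (x ^+ k)%g = g x *+ k.
Hypothesis gV : forall x, g x^-1%g = - g x.

Definition qm_ball (r : R) : set G := [set x | `|g x| <= r].

Hypothesis g_control : forall r eta, 0 < eta -> exists V : set G,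
  [/\ forall x, V x -> V x^-1%g,
      forall s t, qm_ball r s -> qm_ball r t -> V (s / t)%g ->
        `|g s - g t| <= eta &
      exists M, packing_bound V (qm_ball r) M].

Let D_ge0 : 0 <= D.
Proof. exact: le_trans (g_defect 1%g 1%g). Qed.

Let g1 : g 1%g = 0.
Proof. by rewrite -(expg0 1%g) gX mulr0n. Qed.

Lemma qm_defectK x y : g (x * y)%g = qm_defect g x y + (g x + g y).
Proof. by rewrite /qm_defect -[_ - _ - _]addrA -opprD subrK. Qed.

Lemma qm_ballM r r' x y :
  qm_ball r x -> qm_ball r' y -> qm_ball (r + r' + D) (x * y)%g.
Proof.
rewrite /qm_ball /= => xr yr'.
rewrite qm_defectK.
have := g_defect x y; have := ler_normD (qm_defect g x y) (g x + g y).
have := ler_normD (g x) (g y); lra.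
Qed.

Lemma qm_ball_div x y : qm_ball (`|g x - g y| + D) (x / y)%g.
Proof.
rewrite /qm_ball /= qm_defectK gV.
have := g_defect x y^-1%g.
have := ler_normD (qm_defect g x y^-1%g) (g x - g y); lra.
Qed.

(* The elements of [S] in one cell, translated by a member, lie near the
   identity. *)
Lemma packing_growth V (N p : nat) (S : seq G) :
  is_packing V S -> seq_in S (qm_ball N%:R) ->
  packing_bound V (qm_ball (1 + D)) p ->
  (size S <= (N.*2).+1 ^ n * p)%N.
Proof.
move=> Ss SN pb.
pose c s := cell N (g s).
have -> : (size S = \sum_(a : {ffun 'I_n -> 'I_(N.*2).+1})
    count (fun s => c s == a) S)%N.
  under eq_bigr do rewrite -sum1_count big_mkcond /=.
  rewrite exchange_big /= -sum1_size; apply: eq_bigr => s _.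
  by rewrite -big_mkcond /= (big_pred1 (c s))// => a /=; rewrite eq_sym.
have -> : ((N.*2).+1 ^ n * p =
    \sum_(a : {ffun 'I_n -> 'I_(N.*2).+1}) p)%N.
  by rewrite sum_nat_const card_ffun !card_ord.
apply: leq_sum => a _; rewrite -size_filter.
have Fs := is_packing_filter (fun s => c s == a) Ss.
case E : [seq s <- S | c s == a] => [//|s0 F].
rewrite -E -(size_map (fun s => s * s0^-1)%g); apply: pb.
  exact: is_packing_translate.
have inF s : s \in [seq s <- S | c s == a] -> c s = a /\ qm_ball N%:R s.
  by rewrite mem_filter => /andP[/eqP ? /SN].
have [c0 s0N] : c s0 = a /\ qm_ball N%:R s0 by apply: inF; rewrite E mem_head.
move=> _ /mapP[s /inF[cs sN] ->].
apply: le_trans (qm_ball_div s s0) _; rewrite lerD2r.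
by apply: cell_dist sN s0N _; rewrite -/(c s) cs.
Qed.

(** Growth by a factor [1 + delta] at each of [J] steps would contradict the polynomial bound of
    [packing_growth]. The order of quantifiers matters: [J] is chosen before [V]. *)
Lemma slow_growth_step (r0 c : nat) (delta : R) :
  1 + D <= r0%:R -> 0 < delta ->
  exists J : nat, forall V M,
    packing_bound V (qm_ball (r0 + J * c)%:R) M ->
    exists j p p', [/\ (j < J)%N, (0 < p)%N,
      packing_number V (qm_ball (r0 + j * c)%:R) p,
      packing_number V (qm_ball (r0 + j.+1 * c)%:R) p' &
      p'%:R <= (1 + delta) * p%:R].
Proof.
move=> r0D d0.
have [J HJ] := @poly_lt_exp R (r0.*2).+1 (c.*2) n delta d0.
exists J => V M VM.
have sub (r r' : R) : r <= r' -> qm_ball r `<=` qm_ball r'.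
  by move=> rr' x /le_trans; apply.
have bnd (r r' : R) m : r <= r' ->
    packing_bound V (qm_ball r') m -> packing_bound V (qm_ball r) m.
  by move=> rr' pb S Ss Sr; apply: pb => // s /Sr; exact: sub.
have rle j : (j <= J)%N -> (r0 + j * c)%:R <= (r0 + J * c)%:R :> R.
  by move=> jJ; rewrite ler_nat leq_add2l leq_mul2r jJ orbT.
have /choice[p pP] : forall j, exists m, (j <= J)%N ->
    packing_number V (qm_ball (r0 + j * c)%:R) m.
  move=> j; have [jJ|] := leqP j J; last by exists 0%N.
  by have [m ?] := packing_numberP (bnd _ _ _ (rle _ jJ) VM); exists m.
have p0 j : (j <= J)%N -> (0 < p j)%N.
  move=> /pP; apply: packing_number_gt0; exists 1%g.
  by rewrite /qm_ball /= g1 normr0.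
apply: contrapT => nex.
have fast j : (j < J)%N -> (1 + delta) * (p j)%:R <= (p j.+1)%:R.
  move=> jJ; rewrite leNgt; apply/negP => slow; apply: nex.
  exists j, (p j), (p j.+1); split=> //; [exact/p0/ltnW|exact/pP/ltnW|exact: pP|].
  exact: ltW.
have grow j : (j <= J)%N -> (1 + delta) ^+ j * (p 0%N)%:R <= (p j)%:R.
  elim: j => [|j IH] jJ; first by rewrite mul1r.
  apply: le_trans (fast _ jJ); rewrite exprS -mulrA ler_pM2l ?IH ?(ltnW jJ)//.
  lra.
have [_ [S [Ss SN Sp]]] := pP J (leqnn J).
(* As [1 + D <= r0], the number [p 0] also bounds packings of the ball of radius [1 + D]. It is a
   factor in both bounds on [p J] and cancels, which frees [J] from [V]. *)
have [p0b _] := pP 0%N (leq0n J).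
have := packing_growth Ss SN (bnd _ _ _ _ p0b).
rewrite mul0n addn0 => /(_ r0D); rewrite Sp => pJ.
have := grow J (leqnn J); apply/negP; rewrite -ltNge.
apply: (@le_lt_trans _ _ (((r0 + J * c).*2.+1 ^ n * p 0%N)%N%:R)).
  by rewrite ler_nat.
rewrite natrM ltr_pM2r ?ltr0n ?p0//; apply: le_lt_trans HJ.
by rewrite ler_nat -!muln2; apply: eq_leq; congr (_ ^ _)%N; lia.
Qed.

Lemma almost_additive (i : 'I_n) (c : nat) (eps : R) : 0 < eps ->
  exists h : G -> R, (forall w, `|h w - g w ord0 i| <= D) /\
    forall z w, qm_ball c%:R z -> qm_ball c%:R w ->
      `|h (z * w)%g - h z - h w| <= eps.
Proof.
move=> eps0; pose q x := g x ord0 i.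
have [b bD] : exists b : nat, 1 + D <= b%:R.
  by exists (Num.truncn (1 + D)).+1; apply/ltW; exact: truncnS_gt.
(* [m] bounds [c + D], which is both the growth of the radius under right translation by an element
   of the ball of radius [c] and the change of [q] under it. *)
pose m := (c + b)%N.
have cm : c%:R + D <= m%:R by rewrite /m natrD; lra.
have qD x y : `|q (x * y)%g - q x - q y| <= D.
  by apply: le_trans (g_defect x y); have := coord_le_norm (qm_defect g x y) i;
    rewrite !mxE.
have q_shift x y : qm_ball c%:R y -> `|q (x * y)%g - q x| <= m%:R.
  move=> /(le_trans (coord_le_norm (g y) i)); rewrite -/(q y).
  have := qD x y; have := ler_normD (q (x * y)%g - q x - q y) (q y).
  by rewrite subrK; lra.
pose M : R := m%:R; have M0 : 0 <= M by exact: ler0n.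
(* Each of [2 * eta] and [2 * M * delta] is at most [eps / 2]. *)
pose eta := eps / 4; pose delta := eps / (4 * (M + 1)).
have eta0 : 0 < eta by rewrite /eta; lra.
have delta0 : 0 < delta by rewrite /delta divr_gt0//; lra.
have total : 2 * eta + 2 * M * delta <= eps.
  have -> : 2 * M * delta = (eps / 2) * (M / (M + 1)).
    by rewrite /delta; field; lra.
  have : (eps / 2) * (M / (M + 1)) <= (eps / 2) * 1.
    by rewrite ler_pM2l ?ler_pdivrMr; lra.
  by rewrite /eta; lra.
have [J HJ] := slow_growth_step m bD delta0.
(* The extra [m] in the radius makes room for [s * w]; [eta / 2] is used because the averaged
   function is a difference of two values of [q]. *)
have [V [Vsym Vg [N VN]]] :=
  @g_control ((b + J * m)%:R + m%:R) (eta / 2) (divr_gt0 eta0 (ltr0n _ 2)).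
have VNJ : packing_bound V (qm_ball (b + J * m)%:R) N.
  move=> S Ss SN; apply: VN => // s /SN; rewrite /qm_ball /=.
  by move=> /le_trans; apply; rewrite lerDl.
have [j [p [p' [jJ p0 [pmax [S [Ss SN Sp]]] [pmax' _] pp']]]] := HJ V N VNJ.
have jmJ : (b + j.+1 * m)%:R <= (b + J * m)%:R :> R.
  by rewrite ler_nat leq_add2l leq_mul2r jJ orbT.
(* [S] is a maximal packing of the ball one step smaller; [B] contains both [S] and [S z], and its
   packings have at most [p' - p] more elements than [S]. *)
pose B := qm_ball (b + j.+1 * m)%:R.
have ballB z s : qm_ball c%:R z -> s \in S -> B (s * z)%g.
  move=> zc /SN sS; apply: le_trans (qm_ballM sS zc) _.
  by rewrite mulSn addnCA [leRHS]natrD; lra.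
have BV s : B s -> qm_ball ((b + J * m)%:R + m%:R) s.
  by move=> /le_trans; apply; rewrite (le_trans jmJ)// lerDl.
have BVM s z : B s -> qm_ball c%:R z ->
    qm_ball ((b + J * m)%:R + m%:R) (s * z)%g.
  by move=> Bs zc; apply: le_trans (qm_ballM Bs zc) _; lra.
have SB : seq_in S B.
  by move=> s /SN /le_trans; apply; rewrite ler_nat leq_add2l leq_mul2r leqnSn orbT.
have pp : (p <= p')%N by rewrite -Sp; exact: pmax'.
have S0 : 0 < (size S)%:R :> R by rewrite Sp ltr0n.
have S_const (a : R) : \sum_(s <- S) a = a * (size S)%:R.
  by rewrite big_const_seq count_predT iter_addr addr0 mulr_natr.
exists (fun w => (\sum_(s <- S) (q (s * w)%g - q s)) / (size S)%:R); split.
  move=> w; rewrite -/(q w) -[q w](mulfK (lt0r_neq0 S0)) -S_const -mulrBl.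
  rewrite normrM normfV [`|(size S)%:R|]gtr0_norm// ler_pdivrMr//.
  rewrite -sumrB -S_const; apply: le_trans (ler_norm_sum _ _ _) _.
  by apply: ler_sum => s _; exact: qD.
move=> z w zc wc.
rewrite -!mulrBl normrM normfV [`|(size S)%:R|]gtr0_norm// ler_pdivrMr//.
(* The defect of additivity of [h] is the average change of [q (s * w) - q s] when [s] becomes
   [s * z]. *)
have -> : \sum_(s <- S) (q (s * (z * w))%g - q s) -
      \sum_(s <- S) (q (s * z)%g - q s) - \sum_(s <- S) (q (s * w)%g - q s) =
    \sum_(s <- S) ((q (s * z * w)%g - q (s * z)%g) - (q (s * w)%g - q s)).
  by rewrite -!sumrB; apply: eq_bigr => s _; rewrite mulgA; lra.
apply: le_trans (_ : (2 * eta + 2 * M * delta) * (size S)%:R <= _); last first.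
  by rewrite ler_pM2r.
apply: (@norm_sum_translate G R V S B z (fun s => q (s * w)%g - q s) (p' - p)%N).
- exact: eta0.
- exact: Vsym.
- exact: Ss.
- exact: SB.
- by move=> _ /mapP[s sS ->]; exact: ballB.
- by rewrite Sp subnKC.
- move=> s t Bs Bt Vst.
  have h1 : `|q s - q t| <= eta / 2.
    apply: le_trans (Vg _ _ (BV _ Bs) (BV _ Bt) Vst).
    by have := coord_le_norm (g s - g t) i; rewrite !mxE.
  have h2 : `|q (s * w)%g - q (t * w)%g| <= eta / 2.
    have Vw : V ((s * w) / (t * w))%g by rewrite mulgKA.
    apply: le_trans (Vg _ _ (BVM _ _ Bs wc) (BVM _ _ Bt wc) Vw).
    by have := coord_le_norm (g (s * w)%g - g (t * w)%g) i; rewrite !mxE.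
  by move: h1 h2; rewrite !ler_norml; lra.
- by move=> s _; exact: q_shift.
- by rewrite natrB// Sp; lra.
Qed.

Lemma quasimorphism_additive x y : g (x * y)%g = g x + g y.
Proof.
apply/rowP => i; rewrite mxE; apply/eqP; rewrite -subr_eq0 -normr_le0.
apply/ler_addgt0Pr => e e0; rewrite add0r.
pose q x := g x ord0 i.
(* With [k]-th powers the distance [D] between [h] and [q] shrinks to [D / k], at most [e / 8]. *)
have [k k_gt0 kD] : exists2 k, (0 < k)%N & 8 * D <= e * k%:R.
  exists (Num.truncn (8 * D / e)).+1 => //.
  by rewrite [leRHS]mulrC -ler_pdivrMr//; apply/ltW; exact: truncnS_gt.
have k0 : 0 < k%:R :> R by rewrite ltr0n.
pose r := `|g x| + `|g y| + `|g (x * y)%g|.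
(* Large enough for the powers up to [k] of [x], [y] and [x * y]. *)
pose c := (Num.truncn (k%:R * r)).+1.
have [h [hD hA]] := @almost_additive i c (e / 8) (divr_gt0 e0 (ltr0n _ 8)).
have ballX z j : `|g z| <= r -> (j <= k)%N -> qm_ball c%:R (z ^+ j)%g.
  move=> zr jk; rewrite /qm_ball /= gX normrMn -[_ *+ j]mulr_natl.
  apply/ltW; apply: le_lt_trans (truncnS_gt (k%:R * r)).
  by apply: ler_pM => //; rewrite ler_nat.
have hX z j : `|g z| <= r -> (j < k)%N ->
    `|h (z ^+ j.+1)%g - j.+1%:R * h z| <= j.+1%:R * (e / 8).
  move=> zr; elim: j => [|j IH] jk.
    by rewrite expg1 !mul1r subrr normr0; lra.
  have := IH (ltnW jk).
  have zc : qm_ball c%:R z by rewrite -[z]expg1; exact: ballX.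
  have := hA _ _ zc (ballX z j.+1 zr (ltnW jk)); rewrite -expgS.
  rewrite -[j.+2%:R]natr1 !ler_norml; lra.
(* [h (z ^+ k)] is within [k * e / 8] of [k * h z] and within [D] of [k * q z]; divide by [k]. *)
have hq z : `|g z| <= r -> `|h z - q z| <= e / 4.
  move=> zr; have hXk : `|h (z ^+ k)%g - k%:R * h z| <= k%:R * (e / 8).
    by have := hX z k.-1 zr; rewrite prednK// => /(_ (leqnn _)).
  have hDk : `|h (z ^+ k)%g - k%:R * q z| <= D.
    by have := hD (z ^+ k)%g; rewrite gX mulmxnE mulr_natl.
  have : k%:R * `|h z - q z| <= k%:R * (e / 4); last by rewrite ler_pM2l.
  rewrite -[X in X * `|_|](gtr0_norm k0) -normrM.
  by move: hXk hDk; rewrite !ler_norml; lra.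
have := hq x; have := hq y; have := hq (x * y)%g.
have xr : `|g x| <= r by rewrite /r -addrA lerDl addr_ge0.
have yr : `|g y| <= r by rewrite /r addrAC lerDr addr_ge0.
have xyr : `|g (x * y)%g| <= r by rewrite /r lerDr addr_ge0.
have := hA x y.
have zc z : `|g z| <= r -> qm_ball c%:R z.
  by move=> zr; rewrite -[z]expg1; exact: ballX.
move=> /(_ (zc _ xr) (zc _ yr)) h4 /(_ xyr) h1 /(_ yr) h2 /(_ xr) h3.
move: h1 h2 h3 h4; rewrite -/(q x) -/(q y) -/(q (x * y)%g) !ler_norml; lra.
Qed.

End Additivity.

(** * Continuity and compactness in topological groups *)

Section TopologicalGroups.
Variable L : topologicalGroupType.
Implicit Types C U : set L.

Lemma cvg_mulg (T : Type) (F : set_system T) (FF : Filter F) (a b : T -> L) (x y : L) :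
  a @ F --> x -> b @ F --> y -> (fun t => (a t * b t)%g) @ F --> (x * y)%g.
Proof. by apply: continuous2_cvg; exact: (@mulg_continuous L (x, y)). Qed.

Lemma cvg_invg (T : Type) (F : set_system T) (FF : Filter F) (a : T -> L) (x : L) :
  a @ F --> x -> (fun t => (a t)^-1%g) @ F --> x^-1%g.
Proof. by move=> ax; apply: continuous_cvg ax; exact: invg_continuous. Qed.

Lemma cvg_expg (T : Type) (F : set_system T) (FF : Filter F) (a : T -> L) (x : L) k :
  a @ F --> x -> (fun t => (a t ^+ k)%g) @ F --> (x ^+ k)%g.
Proof.
move=> ax; elim: k => [|k IH]; first exact: cvg_cst.
rewrite expgS; under eq_fun do rewrite expgS.
exact: cvg_mulg.
Qed.

Lemma compact_mulset C C' : compact C -> compact C' -> compact (mulset C C').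
Proof.
move=> cC cC'.
have -> : mulset C C' = [set (p.1 * p.2)%g | p in C `*` C'].
  apply/seteqP; split => [_ [a Ca [b Cb <-]]|_ [[a b] [/= Ca Cb] <-]].
    by exists (a, b).
  by exists a => //; exists b.
apply: continuous_compact; last exact: compact_setX.
by apply: continuous_subspaceT => p; exact: mulg_continuous.
Qed.

Lemma compact_invset C : compact C -> compact (invset C).
Proof.
move=> cC; apply: continuous_compact => //.
by apply: continuous_subspaceT => p; exact: invg_continuous.
Qed.

(** The quotient is 1 at [u = 1] and jointly continuous in [u] and [t]; compactness makes the
    neighbourhood of 1 uniform in [t]. *)
Lemma tube_expg C U k : compact C -> nbhs (1%g : L) U ->
  \forall u \near (1%g : L), forall t, C t -> U ((u * t) ^+ k / t ^+ k)%g.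
Proof.
move=> /compact_near_coveringP cC U1.
apply: (cC L (nbhs (1%g : L)) (fun u t => U ((u * t) ^+ k / t ^+ k)%g)) => t Ct.
have : (fun p : L * L => (p.2 * p.1) ^+ k / p.1 ^+ k)%g @ (t, 1%g) -->
    ((1 * t) ^+ k / t ^+ k)%g.
  apply: cvg_mulg.
    by apply: cvg_expg; apply: cvg_mulg; [exact: cvg_snd|exact: cvg_fst].
  by apply: cvg_invg; apply: cvg_expg; exact: cvg_fst.
by rewrite mul1g mulgV; apply.
Qed.

Lemma nbhs_divg U : nbhs (1%g : L) U ->
  exists2 V, nbhs (1%g : L) V & forall x y, V x -> V y -> U (x / y)%g.
Proof.
move=> U1.
have : (fun p : L * L => p.1 / p.2)%g @ (1%g, 1%g) --> (1 / 1 : L)%g.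
  by apply: cvg_mulg; [exact: cvg_fst|apply: cvg_invg; exact: cvg_snd].
rewrite mulgV => /(_ _ U1) [[/= V1 V2] [V11 V21] VU].
exists (V1 `&` V2); first exact: filterI.
by move=> x y [V1x _] [_ V2y]; exact: (VU (x, y)).
Qed.

Lemma nbhs_translate U t : nbhs (1%g : L) U -> \forall x \near t, U (x / t)%g.
Proof.
have : (fun x => x / t)%g @ t --> (t / t : L)%g.
  by apply: cvg_mulg; [exact: cvg_id|exact: cvg_cst].
by rewrite mulgV; apply.
Qed.

End TopologicalGroups.

(** * Identities for group homomorphisms *)

Section Multiplicative.
Variables (G H : groupType) (f : {multiplicative G -> H}).

Lemma multf1 : f 1%g = 1%g.
Proof. by apply: (@mulgI _ (f 1%g)); rewrite -gmulfM !mulg1. Qed.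

Lemma multfV x : f x^-1%g = (f x)^-1%g.
Proof. by apply: (@mulgI _ (f x)); rewrite -gmulfM !mulgV multf1. Qed.

Lemma multfF x y : f (x / y)%g = (f x / f y)%g.
Proof. by rewrite gmulfM multfV. Qed.

Lemma multfX x k : f (x ^+ k)%g = (f x ^+ k)%g.
Proof.
by elim: k => [|k IH]; [exact: multf1 | rewrite !expgS gmulfM IH].
Qed.

End Multiplicative.

(** * Packing bounds for preimages of compact sets *)

Section PackingCompact.
Variables (G : groupType) (L : topologicalGroupType) (f : {multiplicative G -> L}).

Lemma packing_boundU (V A B : set G) p q :
  packing_bound V A p -> packing_bound V B q -> packing_bound V (A `|` B) (p + q).
Proof.
move=> Ap Bq S Ss SAB.
rewrite -(count_predC (fun s => `[< A s >]) S) -!size_filter; apply: leq_add.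
  apply: Ap; first exact: is_packing_filter.
  by move=> s; rewrite mem_filter => /andP[/asboolP].
apply: Bq; first exact: is_packing_filter.
by move=> s; rewrite mem_filter => /andP[/asboolPn As /SAB[]].
Qed.

Lemma packing_bound_sub (V A B : set G) p :
  A `<=` B -> packing_bound V B p -> packing_bound V A p.
Proof. by move=> AB pb S Ss SA; apply: pb => // s /SA/AB. Qed.

(* The sets whose complement has a finite packing bound form a filter, so near
   covering reduces the bound on a compact set to a local one. *)
Lemma packing_compact (U : set L) (C : set L) :
  nbhs (1%g : L) U -> compact C ->
  exists M, packing_bound [set x | U (f x) /\ U (f x)^-1%g] (f @^-1` C) M.
Proof.
move=> U1 /compact_near_coveringP cC; pose V := [set x | U (f x) /\ U (f x)^-1%g].
pose F : set_system L := [set X | exists M, packing_bound V (f @^-1` (~` X)) M].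
have FF : Filter F.
  split.
  - by exists 0%N => -[//|s S] _ /(_ s (mem_head _ _)) /= /(_ I).
  - move=> X Y [p Xp] [q Yq]; exists (p + q)%N.
    apply: packing_bound_sub (packing_boundU Xp Yq).
    by rewrite setCI.
  - move=> X Y XY [p Xp]; exists p; apply: packing_bound_sub Xp.
    by apply: preimage_subset; exact: subsetC.
have [U' U'1 U'U] := nbhs_divg U1.
(* This set is the complement of [C], so its membership in [F] is the bound sought. *)
have : F [set i | C `<=` (fun x => i <> x)].
  apply: (cC L F (fun i x => i <> x)) => t Ct.
  exists ([set x | U' (x / t)%g], ~` [set x | U' (x / t)%g]).
    split; first exact: nbhs_translate.
    (* Two points over the same translate of [U'] have both quotients in [U], so a packing contains
       at most one. *)
    exists 1%N => -[|s [|s' S]]//= [/andP[ss' _] Ss] SU.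
    have sS : s \in [:: s, s' & S] by rewrite mem_head.
    have s'S : s' \in [:: s, s' & S] by rewrite !inE eqxx orbT.
    have /contrapT Us := SU _ sS; have /contrapT Us' := SU _ s'S.
    have neq : s != s' by apply: contraNneq ss' => ->; rewrite mem_head.
    case: (Ss _ _ sS s'S neq); split; rewrite /= multfF ?invgF.
      by rewrite -(mulgKA (t^-1)%g); exact: U'U.
    by rewrite -(mulgKA (t^-1)%g); exact: U'U.
  by move=> [x i] /= [xt it] ix; apply: it; rewrite ix.
move=> [M FM]; exists M; apply: packing_bound_sub FM.
by move=> x /= Cx /(_ _ Cx).
Qed.

End PackingCompact.

(** * Uniform continuity of the quasimorphism for the pulled back topology *)

Section Control.
Variables (G : groupType) (R : realType) (n : nat) (g : G -> 'rV[R]_n) (D : R).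
Variables (L : topologicalGroupType) (f : {multiplicative G -> L}).
Hypothesis g_defect : forall x y, `|qm_defect g x y| <= D.
Hypothesis gX : forall x k, g (x ^+ k)%g = g x *+ k.
Hypothesis gV : forall x, g x^-1%g = - g x.

(* For [s = ut] with [f u] close to 1, the element [s^k t^-k] stays in a fixed
   neighbourhood, so [k (g s - g t)] is bounded independently of [k]. *)
Lemma qm_control U b : nbhs (1%g : L) U -> (forall x, U (f x) -> `|g x| <= b) ->
  (forall r, exists2 C, compact C & forall x, qm_ball g r x -> C (f x)) ->
  forall r eta, 0 < eta -> exists V : set G,
  [/\ forall x, V x -> V x^-1%g,
      forall s t, qm_ball g r s -> qm_ball g r t -> V (s / t)%g ->
        `|g s - g t| <= eta &
      exists M, packing_bound V (qm_ball g r) M].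
Proof.
move=> U1 gU gC r eta eta0; have [C cC Cr] := gC r.
(* The norm of [k * (g s - g t)] will be at most [b + D]. *)
pose k := (Num.truncn ((b + D) / eta)).+1.
have kb : b + D <= k%:R * eta.
  by rewrite -ler_pdivrMr//; apply/ltW; exact: truncnS_gt.
pose N := [set u | forall t, C t -> U ((u * t) ^+ k / t ^+ k)%g].
have tube : nbhs (1%g : L) N := tube_expg k cC U1.
exists [set x | N (f x) /\ N (f x)^-1%g]; split.
- by move=> x [Nx NVx]; split; rewrite multfV ?invgK.
- move=> s t _ rt [Nst _]; have := Nst _ (Cr _ rt).
  rewrite multfF mulgVK -!multfX -multfF => /gU gst.
  have k0 : 0 < k%:R :> R by rewrite ltr0n.
  rewrite -(ler_pM2l k0) -[X in X * `|_|](gtr0_norm k0) -normrZ scaler_nat mulrnBl -!gX.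
  have := qm_defectK g (s ^+ k) (t ^- k); rewrite gV => gE.
  have -> : g (s ^+ k)%g - g (t ^+ k)%g =
      g (s ^+ k / t ^+ k)%g - qm_defect g (s ^+ k)%g (t ^- k)%g.
    by rewrite gE addrAC subrr add0r.
  have := ler_normB (g (s ^+ k / t ^+ k)%g) (qm_defect g (s ^+ k)%g (t ^- k)%g).
  by have := g_defect (s ^+ k)%g (t ^- k)%g; lra.
- have [M MC] := packing_compact f tube cC.
  by exists M; apply: packing_bound_sub MC => x; exact: Cr.
Qed.

End Control.

(** * Commensurability of sets *)

Section Commensurability.
Variable G : groupType.
Implicit Types A B C : set G.

Lemma right_covered_trans A B C :
  right_covered A B -> right_covered B C -> right_covered A C.
Proof.
move=> [F Ffin AF] [F' F'fin BF']; exists (mulset F' F).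
  exact: finite_image2.
move=> a /AF[b /BF'[c Cc [y F'y <-]] [x Fx <-]].
exists c => //; exists (y * x)%g; last by rewrite mulgA.
by exists y => //; exists x.
Qed.

Lemma right_covered_refl A : right_covered A A.
Proof.
exists [set 1%g]; first exact: finite_set1.
by move=> a Aa; exists a => //; exists 1%g => //; rewrite mulg1.
Qed.

(** The class contains the approximate subgroup [C] that defines it, and [C] is then commensurable
    to both sets. *)
Lemma comm_class_commensurable (omega : set (set G)) A B :
  is_comm_class omega -> omega = comm_class A -> omega = comm_class B ->
  commensurable A B.
Proof.
move=> [C Capprox ->] CA CB.
have CC : comm_class C C by split => //; split; exact: right_covered_refl.
have [_ [CrA ArC]] : comm_class A C by rewrite -CA.
have [_ [CrB BrC]] : comm_class B C by rewrite -CB.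
by split; [exact: right_covered_trans CrB|exact: right_covered_trans CrA].
Qed.

End Commensurability.

(** * Compactness of the images under [f] of balls of [g] *)

Lemma compact_thickening (R : realType) (n : nat) (K W : set 'rV[R]_n) :
  compact K -> K `<=` W° ->
  exists2 e : R, 0 < e & forall u v, K u -> `|v| <= e -> W (u + v).
Proof.
move=> /compact_near_coveringP cK KW.
have : \forall v \near (0 : 'rV[R]_n), K `<=` (fun u => W (u + v)).
  apply: (cK _ (nbhs (0 : 'rV[R]_n)) (fun v u => W (u + v))) => u Ku.
  have : p.1 + p.2 @[p --> ((u : 'rV[R]_n), (0 : 'rV[R]_n))] --> u + 0.
    by apply: cvgD; [exact: cvg_fst|exact: cvg_snd].
  by rewrite addr0; apply; exact: KW.
move=> /nbhs_ballP[e /= e0 eW]; exists (e / 2); first by rewrite divr_gt0.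
move=> u v Ku ve; apply: (eW v) => //.
by rewrite mx_norm_ball /ball_ /= sub0r normrN; lra.
Qed.

Lemma bounded_set_norm (R : realType) (V : normedModType R) (A : set V) :
  bounded_set A -> exists M : R, forall v, A v -> `|v| <= M.
Proof.
move=> [M [_ AM]]; exists (M + 1) => v Av; apply: AM => //; lra.
Qed.

Section CompactBalls.
Variables (G : groupType) (R : realType) (n : nat) (g : G -> 'rV[R]_n).
Variables (L : topologicalGroupType) (f : {multiplicative G -> L}).
Variables (K W : set 'rV[R]_n) (C0 : set L).
Hypothesis gV : forall x, g x^-1%g = - g x.
Hypothesis gK : error_set g K.
Hypothesis KW : K `<=` W°.
Hypothesis C0_compact : compact C0.
Hypothesis W_C0 : forall x, W (g x) -> C0 (f x).

(** Finitely many cells of side [e] cover the values of [g] on the ball. If [x] and [y] share a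
    cell, [g (x / y)] is within [e] of a defect, hence in [W], so [f x] lies in [C0] times [f y]. *)
Lemma qm_ball_compact r :
  exists2 C, compact C & forall x, qm_ball g r x -> C (f x).
Proof.
have [cK _ _ Kg] := gK; have [e e0 eW] := compact_thickening cK KW.
pose N := (Num.truncn (r / e)).+1.
have scaleN x : qm_ball g r x -> `|e^-1 *: g x| <= N%:R.
  move=> xr; rewrite normrZ gtr0_norm ?invr_gt0// mulrC.
  apply/ltW; apply: le_lt_trans (truncnS_gt (r / e)).
  by rewrite ler_pM2r ?invr_gt0.
pose c x := cell N (e^-1 *: g x).
(* One representative per cell, with 1 as default for cells that are not met. *)
have /choice[rep repP] : forall a, exists x0, forall x,
    qm_ball g r x -> c x = a -> qm_ball g r x0 /\ c x0 = a.
  move=> a; have [[x [xr xa]]|no] := pselect (exists x, qm_ball g r x /\ c x = a).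
    by exists x.
  by exists 1%g => x xr xa; case: no; exists x.
exists (mulset C0 (range (f \o rep))).
  apply: compact_mulset => //; apply: finite_compact; apply: finite_image.
  exact: finite_finset.
move=> x xr; have [x0r cx0] := repP _ _ xr erefl.
exists (f (x / rep (c x))%g); last first.
  by exists (f (rep (c x))); [exists (c x)|rewrite -gmulfM mulgVK].
apply: W_C0; rewrite qm_defectK gV; apply: eW; first exact: Kg.
have := cell_dist (scaleN _ xr) (scaleN _ x0r) (esym cx0).
rewrite -scalerBr normrZ gtr0_norm ?invr_gt0// mulrC.
by rewrite ler_pdivrMr// mul1r.
Qed.

End CompactBalls.

(** * From the equality of the two classes to additivity *)

Theorem proposition5p29 (G : groupType) (omega : set (set G))
    (R : realType) (n : nat) (g : G -> 'rV[R]_n)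
    (L : topologicalGroupType) (f : {multiplicative G -> L}) :
  is_comm_class omega ->
  homogeneous_quasimorphism g ->
  is_chi_qm g omega ->
  connected [set: L] ->
  locally_compact [set: L] ->
  dense (range f) ->
  is_chi_hom f omega ->
  forall x y : G, g (x * y)%g = g x + g y.
Proof.
move=> omega_class [_ g_homog] [K [W [gK cW KW omega_g]]] _ _ _
  [U [cU U1 omega_f]].
have gX x k : g (x ^+ k)%g = g x *+ k by exact: (g_homog x (Posz k)).
have gV x : g x^-1%g = - g x.
  by have := g_homog x (Negz 0); rewrite /expgz expg1.
have [cK K0 _ Kg] := gK.
have [D KD] := bounded_set_norm (compact_bounded cK).
have g_defect x y : `|qm_defect g x y| <= D by exact/KD/Kg.
have g1 : g 1%g = 0 by rewrite -(expg0 1%g) gX mulr0n.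
have [] := comm_class_commensurable omega_class omega_g omega_f.
move=> [F Ffin gF] [F' F'fin fF'].
have W0 : W 0 by apply: interior_subset; exact: KW.
(* The first covering puts [f x] in this compact set whenever [g x] is in [W]. *)
pose C0 := mulset (mulset U (invset U)) [set f x | x in F].
have cC0 : compact C0.
  apply: compact_mulset; first exact/compact_mulset/compact_invset.
  exact/finite_compact/finite_image.
have WC0 x : W (g x) -> C0 (f x).
  move=> Wx.
  have /gF[_ [y Uy [_ [y' Uy' <-] <-]] [z Fz <-]] :
      mulset (g @^-1` W) (invset (g @^-1` W)) x.
    exists x => //; exists 1%g; last by rewrite mulg1.
    by exists 1%g; rewrite /= ?invg1 ?g1.
  rewrite gmulfM multfF; exists (f y / f y')%g.
    by exists (f y) => //; exists (f y')^-1%g => //; exists (f y').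
  by exists (f z) => //; exists z.
have [w Ww] := bounded_set_norm (compact_bounded cW).
have [b F'b] := bounded_set_norm
  (compact_bounded (finite_compact (finite_image g F'fin))).
(* By the second covering [x] is [y / y' * z]: [w] bounds [g] at [y] and [y'], [b] at [z], and each
   of the two products adds [D]. *)
have gU x : U (f x) -> `|g x| <= w + w + D + b + D.
  move=> Ux.
  have /fF'[_ [y Wy [_ [y' Wy' <-] <-]] [z F'z <-]] :
      mulset (f @^-1` U) (invset (f @^-1` U)) x.
    exists x => //; exists 1%g; last by rewrite mulg1.
    by exists 1%g; rewrite /= ?invg1 ?multf1//; exact: nbhs_singleton.
  apply: qm_ballM => //; last by apply: F'b; exists z.
  by apply: qm_ballM => //; rewrite /qm_ball /= ?gV ?normrN; exact: Ww.
apply: (@quasimorphism_additive G R n g D) => //.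
apply: qm_control U1 gU _ => //.
exact: qm_ball_compact gV gK KW cC0 WC0.
Qed.
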